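(* Let $m,n$ be positive integers, $A\in\mathcal{M}_{n,m}(\mathbb{F}_q((z^{-1})))$, and let $(\underline{y}_k)_{k\ge1}$ be the sequence of best approximation vectors associated to $A$. If $\|\underline{y}_k\|^{1/k}\to\infty$ as $k\to\infty$, then there exists $\varepsilon>0$ such that $\mathrm{Bad}^{\varepsilon}(A)$ has Hausdorff dimension $n$; more precisely, this holds for every positive real $\varepsilon<q^{-4-\frac{m}{n}}$. Moreover, if $m=n=1$, $A=(\alpha)$ with $\alpha$ irrational, and the degrees of the partial quotients in the continued fraction expansion of $\alpha$ tend to infinity, then $\mathrm{Bad}^{\varepsilon}(\alpha)$ has Hausdorff dimension $1$ for every $0<\varepsilon\le q^{-2}$.
   Context: Let $q$ be a prime power, $\mathbb{F}_q[z]$ the polynomial ring over $\mathbb{F}_q$ and $\mathbb{F}_q((z^{-1}))$ the field of formal Laurent series in $z^{-1}$; for nonzero $x$, $\|x\|=q^{\deg x}$, $\|0\|=0$; a series is irrational if it is not in $\mathbb{F}_q(z)$. For vectors, $\|\underline{v}\|$ is the maximum norm of the coordinates and $|\langle\underline{v}\rangle|=\min_{\underline{y}\text{ polynomial vector}}\|\underline{v}-\underline{y}\|$. $\mathbb{I}=\{x:\|x\|<1\}$. For $\varepsilon>0$, $\mathrm{Bad}^{\varepsilon}(A)=\{\underline{\theta}\in\mathbb{I}^n:\liminf_{\underline{x}\in\mathbb{F}_q[z]^m,\|\underline{x}\|\to\infty}\|\underline{x}\|^{m/n}|\langle A\underline{x}-\underline{\theta}\rangle|\ge\varepsilon\}$,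 and $\mathrm{Bad}^{\varepsilon}(\alpha)=\mathrm{Bad}^{\varepsilon}((\alpha))$. Hausdorff dimension is with respect to the metric $\|\underline{x}-\underline{y}\|$. Best approximations: for $\underline{y}\in\mathbb{F}_q((z^{-1}))^n$ put $M(\underline{y})=|\langle A^T\underline{y}\rangle|$. A sequence $(\underline{y}_i)_{i\ge1}$ of nonzero vectors in $\mathbb{F}_q[z]^n$, with $Y_i=\|\underline{y}_i\|$ and $M_i=M(\underline{y}_i)$, is the sequence of best approximation vectors associated to $A$ (related to $A^T$) if $1=Y_1<Y_2<\cdots$, $M_1>M_2>\cdots$, and $M(\underline{y})\ge M_i$ for every nonzero $\underline{y}\in\mathbb{F}_q[z]^n$ with $\|\underline{y}\|<Y_{i+1}$. Continued fractions: every irrational $\alpha$ has a unique expansion $\alpha=A_0+\cfrac{1}{A_1+\cfrac{1}{A_2+\cdots}}$ with $A_i\in\mathbb{F}_q[z]$, $\deg A_i\ge1$ for $i\ge1$, obtained by $A_0=[\alpha]$ (polynomial part) and iterating $x\mapsto 1/x-[1/x]$ on the fractional part; $A_i$, $i\ge1$, are the partial quotients. *)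

(* Defs.v *)
From HB Require Import structures.
From mathcomp Require Import all_boot all_order all_algebra.
From mathcomp Require Import zify.
From mathcomp Require Import all_classical all_reals all_analysis.

Set Implicit Arguments.
Unset Strict Implicit.
Unset Printing Implicit Defensive.

Import Order.TTheory GRing.Theory Num.Theory.
Import numFieldNormedType.Exports.

Local Open Scope classical_set_scope.
Local Open Scope ring_scope.

(* Formal Laurent series over F in z^-1: [lcoef x k] is the coefficient of
   z^k, which vanishes for all large k. *)

Record laurent (F : fieldType) := Laurent {
  lcoef : int -> F;
  lcoef_bounded : exists N : int, forall k, N < k -> lcoef k = 0 }.

HB.instance Definition _ (F : fieldType) := gen_eqMixin (laurent F).
HB.instance Definition _ (F : fieldType) := gen_choiceMixin (laurent F).

Section LaurentField.
Variable F : fieldType.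
Implicit Types x y w : laurent F.

Lemma laurentP x y : lcoef x =1 lcoef y -> x = y.
Proof.
case: x y => [f pf] [g pg] /= /funext fg; case: _ / fg pg => pg.
by rewrite (Prop_irrelevance pf pg).
Qed.

Lemma lzero_bounded : exists N : int, forall k : int, N < k -> (0 : F) = 0.
Proof. by exists 0. Qed.

Lemma lopp_bounded x :
  exists N : int, forall k, N < k -> - lcoef x k = 0.
Proof. by case: (lcoef_bounded x) => N Nx; exists N => k /Nx ->; rewrite oppr0. Qed.

Lemma ladd_bounded x y :
  exists N : int, forall k, N < k -> lcoef x k + lcoef y k = 0.
Proof.
case: (lcoef_bounded x) (lcoef_bounded y) => N Nx [M My].
by exists (Num.max N M) => k; rewrite gt_max => /andP[/Nx -> /My ->]; rewrite addr0.
Qed.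

(* The sum over all integers has finite support. *)
Definition lmul_coef x y (k : int) : F :=
  \sum_(i \in [set: int]) lcoef x i * lcoef y (k - i).

Lemma lmul_coef_high x y (N M : int) :
  (forall k, N < k -> lcoef x k = 0) -> (forall k, M < k -> lcoef y k = 0) ->
  forall k, N + M < k -> lmul_coef x y k = 0.
Proof.
move=> Nx My k NMk; rewrite /lmul_coef fsbig1// => i _.
have [/Nx ->|iN] := ltP N i; first by rewrite mul0r.
rewrite (My (k - i)) ?mulr0// ltrBrDl (le_lt_trans _ NMk)//.
by rewrite lerD2r.
Qed.

Lemma lmul_coefE x y (N M : int) :
  (forall k, N < k -> lcoef x k = 0) -> (forall k, M < k -> lcoef y k = 0) ->
  forall n : nat, lmul_coef x y (N + M - n%:Z) =
    \sum_(i < n.+1) lcoef x (N - i%:Z) * lcoef y (M - (n - i)%N%:Z).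
Proof.
move=> Nx My n; rewrite /lmul_coef.
have inj : set_inj `I_n.+1 (fun i : nat => N - i%:Z).
  by move=> i j _ _ /addrI/oppr_inj [].
rewrite -(fsbig_widen ((fun i : nat => N - i%:Z) @` `I_n.+1))//=; last first.
  move=> k [_ /= kI]; have [/Nx ->|kN] := ltP N k; first by rewrite mul0r.
  rewrite (My (N + M - n%:Z - k)) ?mulr0//.
  have kn : ~~ (`|N - k| < n.+1)%N.
    by apply/negP => ?; apply: kI; exists `|N - k|%N => //; lia.
  by lia.
rewrite fsbig_image//= -(fsbig_ord _ n.+1 (fun i : nat =>
  lcoef x (N - i%:Z) * lcoef y (N + M - n%:Z - (N - i%:Z)))).
by apply: eq_bigr => -[i /= ilt] _; congr (_ * lcoef y _); lia.
Qed.

Lemma lmul_bounded x y :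
  exists N : int, forall k, N < k -> lmul_coef x y k = 0.
Proof.
case: (lcoef_bounded x) (lcoef_bounded y) => N Nx [M My].
by exists (N + M); exact: lmul_coef_high.
Qed.

Lemma lone_bounded :
  exists N : int, forall k : int, N < k -> (k == 0)%:R = 0 :> F.
Proof. by exists 0 => k; case: eqP => // ->; rewrite ltxx. Qed.

Definition lzero := Laurent lzero_bounded.
Definition lone := Laurent lone_bounded.
Definition lopp x := Laurent (lopp_bounded x).
Definition ladd x y := Laurent (ladd_bounded x y).
Definition lmul x y := Laurent (lmul_bounded x y).

Lemma laddA : associative ladd.
Proof. by move=> x y w; apply: laurentP => k /=; rewrite addrA. Qed.

Lemma laddC : commutative ladd.
Proof. by move=> x y; apply: laurentP => k /=; rewrite addrC. Qed.

Lemma ladd0x : left_id lzero ladd.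
Proof. by move=> x; apply: laurentP => k /=; rewrite add0r. Qed.

Lemma laddNx : left_inverse lzero lopp ladd.
Proof. by move=> x; apply: laurentP => k /=; rewrite addNr. Qed.

HB.instance Definition _ :=
  GRing.isZmodule.Build (laurent F) laddA laddC ladd0x laddNx.

Let trunc x (N : int) (n : nat) : {poly F} := \poly_(i < n) lcoef x (N - i%:Z).

Let lmul_trunc x y (N M : int) :
  (forall k, N < k -> lcoef x k = 0) -> (forall k, M < k -> lcoef y k = 0) ->
  forall n l : nat, (n < l)%N ->
    lmul_coef x y (N + M - n%:Z) = (trunc x N l * trunc y M l)`_n.
Proof.
move=> Nx My n l nl; rewrite (lmul_coefE Nx My) coefM; apply: eq_bigr => -[i ilt] _ /=.
by rewrite !coef_poly (leq_trans ilt nl) (leq_ltn_trans (leq_subr _ _) nl).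
Qed.

Lemma lmulC : commutative lmul.
Proof.
move=> x y; case: (lcoef_bounded x) (lcoef_bounded y) => N Nx [M My].
apply: laurentP => k /=; have [kl|kl] := ltP (N + M) k.
  by rewrite (lmul_coef_high Nx My)// (lmul_coef_high My Nx)// addrC.
have -> : k = N + M - (absz (N + M - k)%R)%:Z by lia.
rewrite (lmul_trunc Nx My (ltnSn _)) [N + M]addrC (lmul_trunc My Nx (ltnSn _)).
by rewrite mulrC.
Qed.

Lemma lmulA : associative lmul.
Proof.
move=> x y w; case: (lcoef_bounded x) (lcoef_bounded y) => N Nx [M My].
case: (lcoef_bounded w) => L Lw.
have NMxy := lmul_coef_high Nx My; have MLyw := lmul_coef_high My Lw.
apply: laurentP => k; have [kl|kl] := ltP (N + M + L) k.
  rewrite /= (@lmul_coef_high (lmul x y) w _ _ NMxy Lw)//.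
  by rewrite (@lmul_coef_high x (lmul y w) _ _ Nx MLyw)// addrA.
have -> : k = N + M + L - (absz (N + M + L - k)%R)%:Z by lia.
move: (absz _) => n {kl}.
have -> : lcoef (lmul (lmul x y) w) (N + M + L - n%:Z) =
          (trunc x N n.+1 * trunc y M n.+1 * trunc w L n.+1)`_n.
  rewrite /= (@lmul_coefE (lmul x y) w _ _ NMxy Lw) coefM.
  apply: eq_bigr => -[i ilt] _ /=; rewrite (lmul_trunc Nx My ilt).
  by congr (_ * _); rewrite coef_poly ltnS leq_subr.
rewrite -mulrA -[N + M + L]addrA /= (@lmul_coefE x (lmul y w) _ _ Nx MLyw) coefM.
apply: eq_bigr => -[i ilt] _ /=.
by rewrite (@lmul_trunc y w _ _ My Lw _ n.+1) ?ltnS ?leq_subr// coef_poly ilt.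
Qed.

Lemma lmul1x : left_id lone lmul.
Proof.
move=> x; apply: laurentP => k /=; rewrite /lmul_coef.
rewrite -(fsbig_widen [set 0])//= ?fsbig_set1 ?mul1r ?subr0//.
by move=> i [_ /= /eqP/negPf ->]; rewrite mul0r.
Qed.

Lemma lmulDl : left_distributive lmul ladd.
Proof.
move=> x y w; case: (lcoef_bounded x) (lcoef_bounded y) => N Nx [M My].
case: (lcoef_bounded w) => L Lw.
pose B := Num.max N M.
have Bx k : B < k -> lcoef x k = 0 by rewrite gt_max => /andP[/Nx].
have By k : B < k -> lcoef y k = 0 by rewrite gt_max => /andP[_ /My].
have Bxy k : B < k -> lcoef (ladd x y) k = 0.
  by move=> Bk /=; rewrite Bx// By// addr0.
apply: laurentP => k /=; have [kl|kl] := ltP (B + L) k.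
  by rewrite !(@lmul_coef_high _ w B L)// addr0.
have -> : k = B + L - (absz (B + L - k)%R)%:Z by lia.
rewrite !(@lmul_coefE _ w B L)// -big_split; apply: eq_bigr => i _ /=.
by rewrite mulrDl.
Qed.

Lemma lone_neq0 : lone != 0.
Proof.
apply/eqP => /(congr1 (fun x => lcoef x 0))/= /eqP.
by rewrite oner_eq0.
Qed.

HB.instance Definition _ := GRing.Zmodule_isComNzRing.Build (laurent F)
  lmulA lmulC lmul1x lmulDl lone_neq0.

Lemma linv_exists x : x != 0 -> exists y, y * x = 1.
Proof.
move=> x0; case: (lcoef_bounded x) => N Nx.
have [d [xd dx]] : exists d, lcoef x d != 0 /\ forall k, d < k -> lcoef x k = 0.
  have [k0 xk0] : exists k, lcoef x k != 0.
    apply/not_existsP => xE; case/eqP: x0; apply: laurentP => k /=.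
    by apply/eqP/negPn/negP => /xE.
  have k0N : k0 <= N by rewrite leNgt; apply: contra xk0 => /Nx ->.
  have ex : exists i : nat, lcoef x (N - i%:Z) != 0.
    by exists `|N - k0|%N; have -> : N - `|N - k0|%N%:Z = k0 by lia.
  exists (N - (ex_minn ex)%:Z); case: ex_minnP => i xi imin; split=> // k ik.
  have [/Nx//|kN] := ltP N k; apply/eqP/negPn/negP => xk.
  have := imin `|N - k|%N; have -> : N - `|N - k|%N%:Z = k by lia.
  by move=> /(_ xk); lia.
pose a := lcoef x d.
pose step (s : seq F) := rcons s (if size s == 0%N then a^-1 else
  - a^-1 * \sum_(i < size s) s`_i * lcoef x (d - (size s - i)%N%:Z)).
pose t n := iter n step [::].
have size_t n : size (t n) = n by elim: n => //= n IH; rewrite size_rcons IH.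
pose h n := (t n.+1)`_n.
have th n i : (i < n)%N -> (t n)`_i = h i.
  elim: n => // n IH; rewrite ltnS leq_eqVlt => /orP[/eqP ->//|ilt].
  by rewrite /= nth_rcons size_t ilt IH.
have h0 : h 0%N = a^-1 by [].
have hS n : h n.+1 = - a^-1 * \sum_(i < n.+1) h i * lcoef x (d - (n.+1 - i)%N%:Z).
  rewrite {1}/h [t _]/(step (t n.+1)) nth_rcons size_t ltnn eqxx/=.
  by congr (_ * _); apply: eq_bigr => -[i ilt] _ /=; rewrite -(th n.+1).
have yb : exists M : int, forall k, M < k ->
    (if k <= - d then h (absz (- d - k)%R) else 0) = 0.
  by exists (- d) => k; rewrite ltNge => /negPf ->.
pose y := Laurent yb.
have dy k : - d < k -> lcoef y k = 0 by rewrite ltNge /= => /negPf ->.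
have yh n : lcoef y (- d - n%:Z) = h n.
  rewrite /= ifT; last by lia.
  by congr h; lia.
exists y; apply: laurentP => k.
rewrite -[RHS]/((k == 0)%:R) -[LHS]/(lmul_coef y x k).
have [kl|kl] := ltP 0 k.
  by rewrite (lmul_coef_high dy dx) ?addNr//= gt_eqF.
have kE : k = - d + d - `|k|%N%:Z by lia.
rewrite {1}kE (lmul_coefE dy dx).
have -> : (k == 0) = (`|k|%N == 0%N) by rewrite absz_eq0.
case: `|k|%N => [|n].
  by rewrite big_ord_recl big_ord0 yh h0 subn0 subr0 addr0 mulVf.
rewrite big_ord_recr subnn subr0 -/a yh.
rewrite (eq_bigr (fun i : 'I_n.+1 => h i * lcoef x (d - (n.+1 - i)%N%:Z))); last first.
  by move=> i _; rewrite -yh.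
rewrite hS mulNr mulNr mulrAC mulVf//.
by rewrite mul1r; exact: addrN.
Qed.

Definition linv x : laurent F :=
  if pselect (x != 0) is left x0 then projT1 (cid (linv_exists x0)) else 0.

Lemma linvVx x : x != 0 -> linv x * x = 1.
Proof. by rewrite /linv; case: pselect => // x0 _; case: cid. Qed.

Lemma linv0 : linv 0 = 0.
Proof. by rewrite /linv; case: pselect => // x0; exfalso; move: x0; rewrite eqxx. Qed.

HB.instance Definition _ :=
  GRing.ComNzRing_isField.Build (laurent F) linvVx linv0.

Lemma lpoly_bounded (p : {poly F}) : exists N : int, forall k, N < k ->
  (if k is Posz i then p`_i else 0) = 0.
Proof.
by exists (size p)%:Z => -[i|//]; rewrite ltz_nat => /ltnW/leq_sizeP; apply.
Qed.

Definition lpoly (p : {poly F}) : laurent F := Laurent (lpoly_bounded p).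

Definition ldeg x : int :=
  xget 0 [set d | lcoef x d != 0 /\ forall k, d < k -> lcoef x k = 0].

(* All coefficients of z^k with k > |ldeg x| vanish. *)
Definition polypart x : {poly F} := \poly_(i < `|ldeg x|.+1) lcoef x i%:Z.

Definition laurent_irrational x : Prop :=
  ~ exists p q : {poly F}, q != 0 /\ x = lpoly p / lpoly q.

(* Remainders of the continued fraction algorithm:
   x_0 = x - [x], x_(i+1) = 1/x_i - [1/x_i]. *)
Fixpoint cf_rem x (i : nat) : laurent F :=
  if i is j.+1 then (cf_rem x j)^-1 - lpoly (polypart (cf_rem x j)^-1)
  else x - lpoly (polypart x).

Definition partial_quotient x (i : nat) : {poly F} :=
  if i is j.+1 then polypart (cf_rem x j)^-1 else polypart x.

End LaurentField.

Section Diophantine.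
Variables (R : realType) (F : finFieldType).
Local Notation K := (laurent F).

Definition lnorm (x : K) : R := if x == 0 then 0 else #|F|%:R ^ ldeg x.

Definition vnorm (n : nat) (v : 'cV[K]_n) : R :=
  \big[Num.max/0]_(i < n) lnorm (v i 0).

Definition vpoly (n : nat) (x : 'cV[{poly F}]_n) : 'cV[K]_n :=
  map_mx (@lpoly F) x.

(* |<v>|; the infimum is a minimum, attained at the vector of polynomial parts. *)
Definition poly_dist (n : nat) (v : 'cV[K]_n) : R :=
  inf [set vnorm (v - vpoly y) | y in [set: 'cV[{poly F}]_n]].

Definition liminf_infty (m : nat) (u : 'cV[{poly F}]_m -> R) : \bar R :=
  ereal_sup [set ereal_inf [set (u x)%:E | x in [set x | N < vnorm (vpoly x)]]
            | N in [set: R]].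

Definition Bad (n m : nat) (eps : R) (A : 'M[K]_(n, m)) : set 'cV[K]_n :=
  [set theta : 'cV[K]_n | (forall i, lnorm (theta i 0) < 1) /\
    (eps%:E <= liminf_infty (fun x : 'cV[{poly F}]_m =>
       (vnorm (vpoly x) `^ (m%:R / n%:R) *
        poly_dist (A *m vpoly x - theta))%R))%E].

Definition Mdist (n m : nat) (A : 'M[K]_(n, m)) (y : 'cV[{poly F}]_n) : R :=
  poly_dist (A^T *m vpoly y).

(* Sequences are indexed from 1: the value y 0 is irrelevant. *)
Definition best_approximations (n m : nat) (A : 'M[K]_(n, m))
    (y : nat -> 'cV[{poly F}]_n) : Prop :=
  [/\ forall i, (0 < i)%N -> y i != 0,
      vnorm (vpoly (y 1%N)) = 1,
      forall i, (0 < i)%N -> vnorm (vpoly (y i)) < vnorm (vpoly (y i.+1)),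
      forall i, (0 < i)%N -> Mdist A (y i.+1) < Mdist A (y i) &
      forall i, (0 < i)%N -> forall x : 'cV[{poly F}]_n,
        x != 0 -> vnorm (vpoly x) < vnorm (vpoly (y i.+1)) ->
        Mdist A (y i) <= Mdist A x].

End Diophantine.

Section Hausdorff.
Variables (R : realType) (T : Type) (dist : T -> T -> R).
Implicit Types U E : set T.
Local Open Scope ereal_scope.

Definition diameter U : \bar R :=
  ereal_sup [set z | exists x y, [/\ U x, U y & z = (dist x y)%:E]].

(* (diam U)^s, with 0^0 = 1 for nonempty U and value 0 for the empty set. *)
Definition diam_pow (s : R) U : \bar R :=
  if U == set0 then 0 else diameter U `^ s.

Definition hausdorff_premeasure (s delta : R) E : \bar R :=
  ereal_inf [set \sum_(0 <= i <oo) diam_pow s (U i) | U in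
    [set U : nat -> set T | E `<=` \bigcup_i U i /\
       forall i, diameter (U i) <= delta%:E]].

Definition hausdorff_measure (s : R) E : \bar R :=
  ereal_sup [set hausdorff_premeasure s delta E
            | delta in [set delta : R | (0 < delta)%R]].

Definition hausdorff_dim E : \bar R :=
  ereal_inf [set s%:E | s in
    [set s : R | (0 <= s)%R /\ hausdorff_measure s E = 0]].

End Hausdorff.

Definition vdist (R : realType) (F : finFieldType) (n : nat)
  (x y : 'cV[laurent F]_n) : R := vnorm R (x - y).

(* Main.v *)
Require Import Defs.
From mathcomp Require Import all_boot all_order all_algebra.
From mathcomp Require Import zify ring lra.
From mathcomp Require Import all_classical all_reals all_analysis.

Set Implicit Arguments.
Unset Strict Implicit.
Unset Printing Implicit Defensive.

Import Order.TTheory GRing.Theory Num.Theory.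
Import numFieldNormedType.Exports.

Local Open Scope classical_set_scope.
Local Open Scope ring_scope.

(* Let y_k have degree s_k, so that s_0 = 0 and the s_k strictly increase.
   Pairing A x - theta with y_k shows that theta is badly approximable as soon
   as the z^-1 coefficient of <y_k, theta> is nonzero for every k: given x,
   choose the least k for which <A^T y_k, x> has a vanishing z^-1 coefficient.
   The k-th condition is affine in the digits of theta and its deepest digit,
   which occurs at depth s_k through the leading coefficients of y_k, ranges
   freely, so the conditions are triangular: each costs at most a factor q in
   the number of admissible prefixes. As s_k / k tends to infinity, this loss is
   subexponential and the set of such theta has full dimension, for every
   eps <= q^(-1 - m/n). No lacunary subsequence of the y_k is needed, because
   distinct degrees put the conditions at distinct depths. For best approximations the required bound on A^T y_k
   is Dirichlet's theorem; for n = m = 1 the denominators of the convergents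
   play the role of the y_k, and -1 - m/n = -2. *)

Lemma cV_neqP (T : eqType) n (u v : 'cV[T]_n) : u != v -> exists i, u i 0 != v i 0.
Proof.
move=> uv; apply/existsP; apply: contraR uv => /existsPn uv; apply/eqP/colP => i.
by have /negPn/eqP := uv i.
Qed.

(** * Coefficients and degrees of Laurent series *)

Section LaurentCoefficients.
Variable F : fieldType.
Implicit Types (x y : laurent F) (p r : {poly F}) (k e : int).

Lemma lcoefB x y k : lcoef (x - y) k = lcoef x k - lcoef y k.
Proof. by []. Qed.

Lemma lcoef_sum n (f : 'I_n -> laurent F) k :
  lcoef (\sum_i f i) k = \sum_i lcoef (f i) k.
Proof. by apply: (big_morph (fun x => lcoef x k)). Qed.

Lemma lcoefM_high x y a b : (forall k, a < k -> lcoef x k = 0) ->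
  (forall k, b < k -> lcoef y k = 0) ->
  forall k, a + b < k -> lcoef (x * y) k = 0.
Proof. exact: lmul_coef_high. Qed.

(** The bound [N] is free so that all entries of a polynomial vector can be expanded over a common
    range. *)
Lemma lcoef_polyM p x k N : (size p <= N)%N ->
  lcoef (lpoly p * x) k = \sum_(e < N) p`_e * lcoef x (k - e%:Z).
Proof.
move=> pN; rewrite -[LHS]/(lmul_coef (lpoly p) x k) /lmul_coef.
have inj : set_inj `I_N Posz by move=> i j _ _ [].
rewrite -(fsbig_widen (Posz @` `I_N))//=; last first.
  move=> [i|i] [_ /= iI]; last by rewrite mul0r.
  rewrite nth_default ?mul0r// (leq_trans pN)// leqNgt; apply/negP => iN.
  by apply: iI; exists i.
by rewrite fsbig_image//= -(fsbig_ord _ N (fun i : nat => p`_i * lcoef x (k - i%:Z))).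
Qed.

Lemma lpolyD p r : lpoly (p + r) = lpoly p + lpoly r.
Proof.
by apply: laurentP => -[i|i] /=; rewrite ?coefD ?addr0.
Qed.

Lemma lpolyM p r : lpoly (p * r) = lpoly p * lpoly r.
Proof.
apply: laurentP => k; rewrite (@lcoef_polyM _ _ _ (size p))//.
case: k => [k|k] /=; last first.
  by rewrite big1// => i _; case E: (Negz k - _) => [j|j]; rewrite ?mulr0//; lia.
rewrite coefM.
pose f i := p`_i * lcoef (lpoly r) (k%:Z - i%:Z).
(* The two sums have different lengths; both are padded with zero terms up to [M]. *)
pose M := maxn k.+1 (size p).
have fE n : (n <= M)%N -> (forall i, (n <= i)%N -> f i = 0) ->
    \sum_(i < n) f i = \sum_(i < M) f i.
  move=> nM f0; rewrite -!(big_mkord xpredT) (@big_cat_nat _ _ _ n 0 M)//=.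
  rewrite [X in _ = _ + X]big_nat_cond [X in _ = _ + X]big1 ?addr0// => i.
  by case/andP => /andP[/f0].
rewrite -[RHS]/(\sum_(i < size p) f i) fE ?leq_maxr//; last first.
  by move=> i pi; rewrite /f nth_default// mul0r.
rewrite -(fE k.+1) ?leq_maxl//; last first.
  by move=> i ki; rewrite /f; case E: (_ - _) => [j|j]; rewrite /= ?mulr0//; lia.
apply: eq_bigr => -[i ik] _ /=; rewrite /f /=.
by rewrite subzn.
Qed.

Lemma lcoef_subpoly x p k : k < 0 -> lcoef (x - lpoly p) k = lcoef x k.
Proof. by case: k => // k _; rewrite lcoefB subr0. Qed.

(** The default value of [xget] is excluded: counting down from an index above which all
    coefficients vanish, the first nonzero one sits at the required degree. *)
Lemma lcoef_ldeg x : x != 0 ->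
  lcoef x (ldeg x) != 0 /\ forall k, ldeg x < k -> lcoef x k = 0.
Proof.
move=> x0; rewrite /ldeg; case: xgetP => [d _ [] //|noD]; exfalso.
have [N Nx] := lcoef_bounded x.
have [k0 xk0] : exists k, lcoef x k != 0.
  apply/not_existsP => xE; case/eqP: x0; apply: laurentP => k /=.
  by apply/eqP/negPn/negP => /xE.
have k0N : k0 <= N by rewrite leNgt; apply: contra xk0 => /Nx ->.
have ex : exists i : nat, lcoef x (N - i%:Z) != 0.
  by exists `|N - k0|%N; have -> : N - `|N - k0|%N%:Z = k0 by lia.
apply: (noD (N - (ex_minn ex)%:Z)); case: ex_minnP => i xi imin; split=> // k ik.
have [/Nx//|kN] := ltP N k; apply/eqP/negPn/negP => xk.
have := imin `|N - k|%N; have -> : N - `|N - k|%N%:Z = k by lia.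
by move=> /(_ xk); lia.
Qed.

Lemma lcoef_polypart x k : 0 <= k -> lcoef (x - lpoly (polypart x)) k = 0.
Proof.
case: k => // k _; rewrite lcoefB /= coef_poly.
case: ltnP => [_|kd]; rewrite ?subrr// subr0.
have [->//|x0] := eqVneq x 0.
have [_ ->//] := lcoef_ldeg x0; lia.
Qed.

End LaurentCoefficients.

(** * Norms, degrees and distances to polynomial vectors, read off from coefficients *)

Lemma finField_gt1 (F : finFieldType) : (1 < #|F|)%N.
Proof. by apply/card_gt1P; exists 0, 1; rewrite eq_sym oner_neq0. Qed.

Section Norms.
Variables (R : realType) (F : finFieldType).
Local Notation q := (#|F|%:R : R).
Implicit Types (x : laurent F) (k e : int).

Lemma card_field_gt1 : 1 < q.
Proof. by rewrite ltr1n finField_gt1. Qed.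

Lemma card_field_gt0 : 0 < q.
Proof. exact: lt_trans card_field_gt1. Qed.

Lemma lnorm_ge0 x : 0 <= lnorm R x.
Proof. by rewrite /lnorm; case: ifP => // _; rewrite exprz_ge0// ltW ?card_field_gt0. Qed.

Lemma lnorm_le x e : lnorm R x <= q ^ e <-> forall k, e < k -> lcoef x k = 0.
Proof.
rewrite /lnorm; case: ifPn => [/eqP ->|x0].
  by split=> // _; rewrite exprz_ge0// ltW ?card_field_gt0.
have [xd dx] := lcoef_ldeg x0.
rewrite ler_eXz2l ?card_field_gt1//; split=> [de k ek|H].
  by apply: dx; apply: le_lt_trans ek.
by rewrite leNgt; apply/negP => /H xd0; rewrite xd0 eqxx in xd.
Qed.

Lemma lnorm_lt x e : lnorm R x < q ^ e <-> forall k, e <= k -> lcoef x k = 0.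
Proof.
(* Norms are 0 or integral powers of q, so none lies strictly between q^(e-1) and q^e. *)
suff -> : (lnorm R x < q ^ e) = (lnorm R x <= q ^ (e - 1)).
  by split=> [/lnorm_le H k ek|H]; [|apply/lnorm_le => k ek]; apply: H; lia.
rewrite /lnorm; case: ifPn => [_|x0].
  by rewrite exprz_gt0 ?exprz_ge0 ?card_field_gt0// ltW ?card_field_gt0.
by rewrite ltr_eXz2l ?ler_eXz2l ?card_field_gt1//; lia.
Qed.

Lemma vnorm_ge0 n (v : 'cV[laurent F]_n) : 0 <= vnorm R v.
Proof.
by rewrite /vnorm; elim/big_ind: _ => [//|x y x0 y0|i _];
  rewrite ?le_max ?x0 ?lnorm_ge0.
Qed.

Lemma vnorm_le n (v : 'cV[laurent F]_n) e :
  vnorm R v <= q ^ e <-> forall i k, e < k -> lcoef (v i 0) k = 0.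
Proof.
split=> [ve i|H].
  apply/lnorm_le; apply: le_trans ve.
  exact: (le_bigmax_cond _ (fun i => lnorm R (v i 0))).
apply/bigmax_leP; split; first by rewrite exprz_ge0// ltW ?card_field_gt0.
by move=> i _; apply/lnorm_le/H.
Qed.

Lemma vnorm_ge n (v : 'cV[laurent F]_n) i k :
  lcoef (v i 0) k != 0 -> q ^ k <= vnorm R v.
Proof.
move=> vk; rewrite leNgt; apply/negP => lt; case/eqP: vk.
have /lnorm_lt : lnorm R (v i 0) < q ^ k; last exact.
apply: le_lt_trans lt; exact: (le_bigmax_cond _ (fun i => lnorm R (v i 0))).
Qed.

Definition vdeg n (y : 'cV[{poly F}]_n) : nat := \max_i (size (y i 0%R)).-1.

Lemma size_le_vdeg n (y : 'cV[{poly F}]_n) i : (size (y i 0%R) <= (vdeg y).+1)%N.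
Proof.
have /= := @leq_bigmax _ (fun i => (size (y i 0%R)).-1) i.
by rewrite -/(vdeg y); lia.
Qed.

Lemma vdeg_lead n (y : 'cV[{poly F}]_n) : y != 0 -> exists i, (y i 0)`_(vdeg y) != 0.
Proof.
move=> /cV_neqP[i]; rewrite mxE => yi.
have I_gt0 : (0 < #|'I_n|)%N by apply/card_gt0P; exists i.
have [j _ jE] := eq_bigmax_cond (fun i => (size (y i 0%R)).-1) I_gt0.
(* In degree 0 the maximum may be attained at a zero entry, whose [(size _).-1] is also 0; the known
   nonzero entry is used instead. *)
have [vd0|vd0] := posnP (vdeg y).
  exists i; rewrite vd0; have := size_le_vdeg y i; rewrite vd0 => yi1.
  have := yi; rewrite -lead_coef_eq0 /lead_coef.
  by have -> : (size (y i 0)).-1 = 0%N by lia.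
exists j; rewrite /vdeg jE -/(lead_coef (y j 0)) lead_coef_eq0.
by apply: contraTneq vd0 => yj0; rewrite /vdeg jE yj0 size_poly0.
Qed.

Lemma vnorm_vpoly n (y : 'cV[{poly F}]_n) : y != 0 -> vnorm R (vpoly y) = q ^+ vdeg y.
Proof.
move=> y0; apply/le_anti/andP; split.
  apply/(@vnorm_le _ _ (vdeg y)%:Z) => i [k|k]// ky; rewrite mxE /= nth_default//.
  by apply: leq_trans (size_le_vdeg y i) _; lia.
have [i yi] := vdeg_lead y0; apply: (@vnorm_ge _ _ i (vdeg y)%:Z).
by rewrite mxE.
Qed.

(** Subtracting polynomials leaves the coefficients of negative index unchanged, and subtracting the
    polynomial parts clears all the others. *)
Lemma poly_dist_le n (v : 'cV[laurent F]_n) e : e < 0 ->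
  poly_dist R v <= q ^ e <-> forall i k, e < k -> k < 0 -> lcoef (v i 0) k = 0.
Proof.
move=> e0; have lb0 (B : set _) : has_lbound [set vnorm R (v - vpoly y) | y in B].
  by exists 0 => _ [y _ <-]; exact: vnorm_ge0.
split=> [ve i k ek k0|H].
  apply/eqP/negPn/negP => vk.
  suff : q ^ k <= poly_dist R v by move/le_trans => /(_ _ ve); rewrite ler_eXz2l ?card_field_gt1; lia.
  apply: lb_le_inf; first by exists (vnorm R (v - vpoly 0)), 0.
  move=> _ [y _ <-]; apply: (@vnorm_ge _ _ i).
  by rewrite !mxE lcoef_subpoly.
pose P : 'cV[{poly F}]_n := \col_i polypart (v i 0).
apply: (@le_trans _ _ (vnorm R (v - vpoly P))).
  by apply: ge_inf => //; exists P.
apply/vnorm_le => i k ek; rewrite !mxE.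
have [k0|k0] := ltP k 0; first by rewrite lcoef_subpoly// H.
exact: lcoef_polypart.
Qed.

End Norms.

(** * Branches of a tree that avoid a light family of prefixes *)

Section Trees.
Variables (R : realType) (V : finType) (v0 : V) (good : seq V -> pred V) (w : nat -> R).
Hypothesis w_ge0 : forall k, 0 <= w k.
Hypothesis w_split : forall s, w (size s) <= #|good s|%:R * w (size s).+1.

(* Greedy descent: the total weight of the prefixes to be avoided that extend
   the current node stays below the weight of that node. *)
Lemma tree_escape (p : nat -> seq V) :
  (\sum_(0 <= i <oo) (w (size (p i)))%:E < (w 0)%:E)%E ->
  exists d : nat -> V, (forall k, good (mkseq d k) (d k)) /\
    forall i, mkseq d (size (p i)) <> p i.
Proof.
pose f s i : R := if prefix s (p i) then w (size (p i)) else 0.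
pose S s := (\sum_(0 <= i <oo) (f s i)%:E)%E.
have f0 s i : (0 <= (f s i)%:E)%E by rewrite /f lee_fin; case: ifP.
move=> S0.
have step s : exists v, (S s < (w (size s))%:E)%E ->
    good s v /\ (S (rcons s v) < (w (size s).+1)%:E)%E.
  apply/not_existsP => H.
  have sS : (S s < (w (size s))%:E)%E by have /not_implyP[] := H v0.
  have Hv v : good s v -> ((w (size s).+1)%:E <= S (rcons s v))%E.
    by move=> gv; rewrite leNgt; apply/negP => lt; apply: (H v).
  (* Each [p i] properly extending [s] passes through exactly one child, so the sums at the good
     children add up to at most [S s]; if all were overweight, [w_split] would make their total at
     least [w (size s)]. *)
  have : ((w (size s))%:E <= S s)%E.
    apply: (@le_trans _ _ (\sum_(v | good s v) S (rcons s v))%E).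
      apply: (@le_trans _ _ (\sum_(v | good s v) (w (size s).+1)%:E)%E).
        rewrite sumEFin lee_fin sumr_const -mulr_natl; exact: w_split.
      by apply: lee_sum.
    rewrite /S -nneseries_sum//; apply: lee_nneseries => i //.
      by move=> _ _; apply: sume_ge0.
    rewrite sumEFin lee_fin /f => _; case: ifPn => [/prefixP[t ->]|sp].
      case: t => [|v1 t].
        rewrite big1 ?w_ge0// => v _; rewrite cats0.
        by rewrite -[X in prefix _ X]cats0 -cats1 prefix_catr ?eqxx.
      rewrite (bigID (pred1 v1))/= [X in _ + X]big1 ?addr0; last first.
        by move=> v /andP[_ vv1]; rewrite -cats1 prefix_catr// eqxx/= (negPf vv1).
      rewrite (eq_bigr (fun=> w (size (s ++ v1 :: t)))); last first.
        by move=> v /andP[_ /eqP ->]; rewrite -cats1 prefix_catr ?eqxx//= prefix0s eqxx.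
      rewrite big_mkcondl big_pred1_eq; case: ifP => // _; exact: w_ge0.
    rewrite big1// => v _; case: ifPn => // /prefixP[t pE].
    by case/negP: sp; rewrite pE -cats1 -catA; apply: prefix_prefix.
  by rewrite leNgt sS.
have [c cP] := choice step.
pose s k := iter k (fun s => rcons s (c s)) [::].
have s_mk k : mkseq (c \o s) k = s k.
  by elim: k => // k IH; rewrite mkseqS IH.
have size_s k : size (s k) = k by rewrite -s_mk size_mkseq.
have Ss k : (S (s k) < (w k)%:E)%E.
  elim: k => [|k IH]; last by have [] := cP (s k); rewrite size_s.
  by apply: le_lt_trans S0; apply: lee_nneseries => // i _; rewrite /f prefix0s.
exists (c \o s); split=> [k|i].
  by rewrite s_mk /=; have [] := cP (s k); rewrite size_s.
(* A branch through [p i] would have the full weight of [p i] counted at that node, against [Ss]. *)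
rewrite s_mk => pE; have := Ss (size (p i)); rewrite ltNge => /negP; apply.
apply: le_trans (@nneseries_lim_ge _ _ xpredT 0 i.+1 _) => //.
rewrite big_nat_recr//= /f pE prefix_refl.
by apply: leeDr; apply: sume_ge0 => j _; exact: f0.
Qed.

End Trees.

(** * Nonzero Hausdorff measure from a weighted tree *)

Section HausdorffLowerBound.
Variables (R : realType) (T : Type) (dist : T -> T -> R).
Local Open Scope ereal_scope.

Lemma diam_pow_ge0 s (U : set T) : 0 <= diam_pow dist s U.
Proof. by rewrite /diam_pow; case: ifP => // _; exact: poweR_ge0. Qed.

Lemma hausdorff_premeasure_ge0 s delta (E : set T) :
  0 <= hausdorff_premeasure dist s delta E.
Proof.
apply: le_ereal_inf_tmp => _ [U _ <-]; apply: nneseries_ge0 => i _ _.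
exact: diam_pow_ge0.
Qed.

Lemma le_diam_pow s (U : set T) x y r : (0 <= s)%R -> U x -> U y ->
  (0 <= r <= dist x y)%R -> (r `^ s)%R%:E <= diam_pow dist s U.
Proof.
move=> s0 Ux Uy /andP[r0 rxy]; rewrite /diam_pow ifF; last first.
  by apply/negP => /eqP U0; rewrite U0 in Ux.
have rU : r%:E <= diameter dist U.
  apply: (@le_trans _ _ (dist x y)%:E); first by rewrite lee_fin.
  by apply: ereal_sup_ubound; exists x, y.
rewrite -poweR_EFin; apply: gt0_ler_poweR => //; rewrite in_itv/= leey andbT.
  by rewrite lee_fin.
by apply: le_trans rU; rewrite lee_fin.
Qed.

(** A form of the mass distribution principle. Each set of a cover confines its good branches to one
    prefix, of weight at most [C] times its diameter power plus a small error. If the cover sum is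
    small, some good branch escapes all these prefixes and yields an uncovered point of [E]. *)
Lemma hausdorff_measure_tree_neq0 (V : finType) (v0 : V)
    (good : seq V -> pred V) (w : nat -> R) (emb : (nat -> V) -> T)
    (E : set T) (s rho C : R) :
  (forall k, 0 <= w k)%R -> (0 < w 0)%R ->
  (forall t, w (size t) <= #|good t|%:R * w (size t).+1)%R ->
  (forall d, (forall k, good (mkseq d k) (d k)) -> E (emb d)) ->
  (0 <= rho)%R ->
  (forall d d' D, d D != d' D -> rho ^+ D.+1 <= dist (emb d) (emb d'))%R ->
  (0 <= s)%R -> (0 < C)%R -> (forall D, w D <= C * (rho ^+ D.+1) `^ s)%R ->
  (forall eta, 0 < eta -> exists D, w D <= eta)%R ->
  hausdorff_measure dist s E != 0.
Proof.
move=> w_ge0 w0 w_split goodE rho0 sep s0 C0 wC w_small; apply/eqP => HE.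
(* Half of the root weight [w 0] is reserved for [C] times the cover sum, the other half for a
   geometric series of errors. *)
have : hausdorff_premeasure dist s 1 E < (w 0 / (2 * C))%:E.
  apply: (@le_lt_trans _ _ 0); last by rewrite lte_fin divr_gt0// mulr_gt0.
  by rewrite -HE; apply: ereal_sup_ubound; exists 1%R => /=.
move=> /ereal_inf_lt[_ [U [EU _] <-]] Ulow.
pose isgood d := forall k, good (mkseq d k) (d k).
have w2 : (0 < w 0 / 2)%R by rewrite divr_gt0.
have /choice[p pP] i : exists p : seq V,
    (forall d, isgood d -> U i (emb d) -> mkseq d (size p) = p) /\
    (w (size p))%:E <= C%:E * diam_pow dist s (U i) + (w 0 / 2 / (2 ^ i.+1)%:R)%:E.
  have eta0 : (0 < w 0 / 2 / (2 ^ i.+1)%:R)%R by rewrite divr_gt0// ltr0n expn_gt0.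
  pose P D := `[< exists d d',
    [/\ isgood d, isgood d', U i (emb d), U i (emb d') & d D != d' D] >].
  (* At the least [D] where two good branches in [U i] differ, all of them share their first [D]
     digits, and separation bounds the diameter from below by rho^(D+1). *)
  have [exP|noP] := pselect (exists D, P D).
    case: (ex_minnP exP) => D /asboolP[d [d' [gd gd' Ud Ud' dd']]] Dmin.
    exists (mkseq d D); rewrite size_mkseq; split=> [d2 gd2 Ud2|].
      apply/eq_in_map => j; rewrite mem_iota add0n => /andP[_ jD].
      apply/eqP/negPn/negP => dj; have : P j by apply/asboolP; exists d2, d.
      by move=> /Dmin; rewrite leqNgt jD.
    apply: (@le_trans _ _ (C%:E * diam_pow dist s (U i))); last first.
      by apply: leeDl; rewrite lee_fin ltW.
    apply: (@le_trans _ _ (C * (rho ^+ D.+1) `^ s)%:E); first by rewrite lee_fin.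
    rewrite EFinM; apply: lee_wpmul2l; first by rewrite lee_fin ltW.
    by apply: (le_diam_pow s0 Ud Ud'); rewrite exprn_ge0//= sep.
  (* No two good branches in [U i] differ, so its diameter gives no information; a prefix long
     enough for the error term to absorb its weight is taken. *)
  have [D wD] := w_small _ eta0.
  have wD' k : size k = D -> (w (size k))%:E <=
      C%:E * diam_pow dist s (U i) + (w 0 / 2 / (2 ^ i.+1)%:R)%:E.
    move=> ->; apply: (@le_trans _ _ (w 0 / 2 / (2 ^ i.+1)%:R)%:E); first by rewrite lee_fin.
    by apply: leeDr; rewrite mule_ge0 ?diam_pow_ge0// lee_fin ltW.
  have [[d [gd Ud]]|nod] := pselect (exists d, isgood d /\ U i (emb d)).
    exists (mkseq d D); split; last by apply: wD'; rewrite size_mkseq.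
    rewrite size_mkseq => d2 gd2 Ud2; apply/eq_in_map => j _.
    apply/eqP/negPn/negP => dj; apply: noP; exists j; apply/asboolP.
    by exists d2, d.
  exists (nseq D v0); split; last by apply: wD'; rewrite size_nseq.
  by move=> d gd Ud; exfalso; apply: nod; exists d.
have [|d [gd dp]] := @tree_escape R V v0 good w w_ge0 w_split p.
  apply: (@le_lt_trans _ _ (\sum_(0 <= i <oo) (C%:E * diam_pow dist s (U i)
      + (w 0 / 2 / (2 ^ i.+1)%:R)%:E))).
    apply: lee_nneseries => i //; first by rewrite lee_fin.
    by move=> _; have [] := pP i.
  apply: (le_lt_trans (epsilon_trick _ _ (ltW w2))).
    by move=> i; rewrite mule_ge0 ?diam_pow_ge0// lee_fin ltW.
  rewrite nneseriesZl; last by move=> i _; exact: diam_pow_ge0.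
  have -> : (w 0)%:E = C%:E * (w 0 / (2 * C))%:E + (w 0 / 2)%:E.
    by rewrite -EFinM -EFinD; congr (_%:E); field; rewrite gt_eqF.
  by rewrite lteD2rE// lte_pmul2l.
have [i _ Ui] := EU _ (goodE _ gd).
by apply: (dp i); have [+ _] := pP i; apply.
Qed.

End HausdorffLowerBound.

(** * Real powers and geometric decay *)

Section RealPowers.
Variable R : realType.
Implicit Types a s z eta : R.

Lemma powR_exprC a s k : 0 <= a -> (a ^+ k) `^ s = (a `^ s) ^+ k.
Proof. by move=> a0; rewrite -!powR_mulrn ?powR_ge0// powRAC. Qed.

Lemma powR_inv a s : 0 <= a -> a^-1 `^ s = a `^ (- s).
Proof. by move=> a0; rewrite -powR_inv1// -powRrM mulN1r. Qed.

Lemma powR_lt1 a s : 1 < a -> s < 0 -> a `^ s < 1.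
Proof.
move=> a1 s0; rewrite /powR gt_eqF ?(lt_trans ltr01)//.
by rewrite expR_lt1 nmulr_rlt0// ln_gt0.
Qed.

Lemma expr_eventually_le z eta : 0 <= z < 1 -> 0 < eta ->
  exists N, forall k, (N <= k)%N -> z ^+ k <= eta.
Proof.
move=> /andP[z0 z1] eta0.
have : z ^+ k @[k --> \oo] --> 0 by apply: cvg_expr; rewrite ger0_norm.
by move=> /cvgr_le /(_ _ eta0)[N _ HN]; exists N.
Qed.

End RealPowers.

(** * Upper bound for the dimension: covering the unit ball by cylinders *)

Section HausdorffUpperBound.
Variables (R : realType) (F : finFieldType) (n : nat).
Local Notation q := (#|F|%:R : R).
Local Notation unit_ball := [set v : 'cV[laurent F]_n | forall i, lnorm R (v i 0) < 1].

(** [Negz j] is -(j+1), so column [j] holds the coefficients of z^-(j+1). *)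
Definition digits D (v : 'cV[laurent F]_n) : 'M[F]_(n, D) :=
  \matrix_(i, j) lcoef (v i 0) (Negz j).

Lemma vdist_digits D (u v : 'cV[laurent F]_n) :
  unit_ball u -> unit_ball v -> digits D u = digits D v ->
  vdist R u v <= q^-1 ^+ D.+1.
Proof.
move=> u1 v1 /matrixP uv; rewrite exprVn.
apply/(@vnorm_le _ _ _ _ (Negz D)) => i k Dk; rewrite !mxE lcoefB.
case: k Dk => k Dk.
  have /(@lnorm_lt _ _ _ 0) -> // := u1 i.
  by have /(@lnorm_lt _ _ _ 0) -> // := v1 i; rewrite subrr.
have kD : (k < D)%N by lia.
by have := uv i (Ordinal kD); rewrite !mxE/= => ->; rewrite subrr.
Qed.

(** The q^(nD) cylinders of depth D have diameter at most q^-(D+1), so the sum of their s-th powers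
    is at most rho^D with rho = q^(n-s) < 1. *)
Lemma hausdorff_measure_unit_ball_eq0 s (E : set 'cV[laurent F]_n) :
  E `<=` unit_ball -> n%:R < s -> hausdorff_measure (@vdist R F n) s E = 0%E.
Proof.
move=> E1 ns; have s0 : 0 <= s by apply: le_trans (ltW ns).
have q0 := card_field_gt0 R F; have q1 := card_field_gt1 R F.
pose rho : R := q ^+ n * q^-1 `^ s.
have rho0 : 0 <= rho by rewrite mulr_ge0 ?exprn_ge0 ?powR_ge0// ltW.
have rho1 : rho < 1.
  rewrite /rho -powR_mulrn ?ltW// powR_inv ?ltW// -powRD; last by rewrite (gt_eqF q0) implybT.
  by rewrite powR_lt1// subr_lt0.
have le0 delta : (0 < delta)%R ->
    (hausdorff_premeasure (@vdist R F n) s delta E <= 0)%E.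
  move=> delta0; apply/lee_addgt0Pr => eta eta0; rewrite add0e.
  have [D [D1 D2]] : exists D, rho ^+ D <= eta /\ q^-1 ^+ D.+1 <= delta.
    have q11 : 0 <= q^-1 < 1 by rewrite invr_ge0 ltW//= invf_lt1.
    have [N1 HN1] := expr_eventually_le (introT andP (conj rho0 rho1)) eta0.
    have [N2 HN2] := expr_eventually_le q11 delta0.
    exists (maxn N1 N2); split; first by rewrite HN1 ?leq_maxl.
    by rewrite HN2// ltnW// ltnS leq_maxr.
  pose U k := [set v | unit_ball v /\ enum_rank (digits D v) = k :> nat].
  pose N := #|{: 'M[F]_(n, D)}|.
  have Uhigh k : (N <= k)%N -> U k = set0.
    move=> Nk; rewrite -subset0 => v [_ vk]; move: Nk; rewrite -vk leqNgt.
    by rewrite /N ltn_ord.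
  have diamU k : (diameter (@vdist R F n) (U k) <= (q^-1 ^+ D.+1)%:E)%E.
    apply: ge_ereal_sup => _ [u [v [[u1 uk] [v1 vk] ->]]].
    by rewrite lee_fin vdist_digits//; apply/enum_rank_inj/val_inj; rewrite /= uk vk.
  apply: (@le_trans _ _ (\sum_(0 <= k <oo) diam_pow (@vdist R F n) s (U k))%E).
    apply: ereal_inf_lbound; exists U => //; split.
      by move=> v /E1 v1; exists (enum_rank (digits D v)).
    by move=> k; apply: le_trans (diamU k) _; rewrite lee_fin.
  rewrite (nneseries_split 0 N); last by move=> k _; exact: diam_pow_ge0.
  rewrite add0n [X in (_ + X)%E]eseries0 ?adde0; last first.
    by move=> k Nk _; rewrite Uhigh// /diam_pow eqxx.
  apply: (@le_trans _ _ (\sum_(0 <= k < N) ((q^-1 ^+ D.+1) `^ s)%:E)%E).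
    apply: lee_sum => k _; rewrite /diam_pow; case: ifPn => [_|/set0P[v Uv]].
      by rewrite lee_fin powR_ge0.
    have dU0 : (0 <= diameter (@vdist R F n) (U k))%E.
      apply: (@le_trans _ _ (vdist R v v)%:E); first by rewrite lee_fin vnorm_ge0.
      by apply: ereal_sup_ubound; exists v, v.
    rewrite -poweR_EFin; apply: gt0_ler_poweR => //; rewrite in_itv/= leey andbT//.
  rewrite sumEFin lee_fin sumr_const_nat subn0 /N card_mx -[_ *+ (_ ^ _)%N]mulr_natl natrX.
  rewrite powR_exprC ?invr_ge0 ?(ltW q0)// exprM exprS mulrCA -exprMn -/rho.
  apply: le_trans D1; rewrite -[leRHS]mul1r ler_wpM2r ?exprn_ge0//.
  by rewrite -[leRHS](powRr0 q^-1) ger_powR// invr_gt0 q0 invf_le1// ltW.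
apply/le_anti/andP; split; first by apply: ge_ereal_sup => _ [delta /= d0 <-]; exact: le0.
apply: (le_trans (hausdorff_premeasure_ge0 (@vdist R F n) s 1 E)).
by apply: ereal_sup_ubound; exists 1 => /=.
Qed.

Lemma hausdorff_dim_unit_ball_le (E : set 'cV[laurent F]_n) :
  E `<=` unit_ball -> (hausdorff_dim (@vdist R F n) E <= n%:R%:E)%E.
Proof.
move=> E1; apply/lee_addgt0Pr => e e0; apply: ereal_inf_lbound.
exists (n%:R + e); last by rewrite EFinD.
split; first by rewrite addr_ge0// ltW.
by apply: hausdorff_measure_unit_ball_eq0 => //; rewrite ltrDl.
Qed.

End HausdorffUpperBound.

(** * Membership in [Bad]; [r k] encodes |<A^T y_k>| <= q^-(r k) *)

Section BadMembership.
Variables (R : realType) (F : finFieldType) (m n : nat) (A : 'M[laurent F]_(n, m)).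
Variables (y : nat -> 'cV[{poly F}]_n) (s r : nat -> nat).
Hypothesis n_gt0 : (0 < n)%N.
Hypothesis m_gt0 : (0 < m)%N.
Hypothesis s0 : s 0%N = 0%N.
Hypothesis s_mono : forall k, (s k < s k.+1)%N.
Hypothesis size_y : forall k i, (size (y k i 0%R) <= (s k).+1)%N.
Hypothesis Ay_small : forall k j e, (e.+1 < r k)%N ->
  lcoef ((A^T *m vpoly (y k)) j 0) (Negz e) = 0.
Hypothesis rs : forall k, (n * s k.+1 <= m * r k)%N.
Local Notation q := (#|F|%:R : R).

Lemma leq_degrees k : (k <= s k)%N.
Proof. by elim: k => // k IH; apply: leq_ltn_trans IH (s_mono k). Qed.

(* Pairing [A x - theta - w] with [y k] gives [(A^T y k) x] minus [y k theta]
   modulo polynomials; the first term has no [z^-1] coefficient. *)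
Lemma poly_dist_ge (theta : 'cV[laurent F]_n) k (x : 'cV[{poly F}]_m) :
  lcoef (\sum_i lpoly (y k i 0) * theta i 0) (Negz 0) != 0 ->
  (vdeg x + 2 <= r k)%N ->
  q ^ Negz (s k) <= poly_dist R (A *m vpoly x - theta).
Proof.
move=> theta_k xr; apply: lb_le_inf.
  by exists (vnorm R (A *m vpoly x - theta - vpoly 0)), 0.
move=> _ [p _ <-]; rewrite leNgt; apply: contra theta_k => vlt.
set v := (X in vnorm R X) in vlt.
have vi i : lnorm R (v i 0) < q ^ Negz (s k).
  by apply: le_lt_trans vlt; apply: (le_bigmax_cond _ (fun i => lnorm R (v i 0))).
(* [v] has norm below q^-(s_k + 1) and [y k] has degree at most s_k, so the pairing has norm below
   q^-1. *)
have yv : lcoef (\sum_i lpoly (y k i 0) * v i 0) (Negz 0) = 0.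
  rewrite lcoef_sum big1// => i _; rewrite (lcoef_polyM _ _ (size_y k i)) big1// => -[e es] _.
  have /lnorm_lt -> := vi i; rewrite ?mulr0//=; lia.
have <- : \sum_j (A^T *m vpoly (y k)) j 0 * lpoly (x j 0)
    - \sum_i lpoly (y k i 0) * v i 0 - \sum_i lpoly (y k i 0) * lpoly (p i 0)
    = \sum_i lpoly (y k i 0) * theta i 0.
  rewrite -addrA -opprD -big_split/=.
  under [X in _ - X]eq_bigr => i _ do rewrite -mulrDr !mxE subrK mulrDr mulrN.
  rewrite big_split/= sumrN opprD opprK addrA [X in X + _](_ : _ = 0) ?add0r//.
  apply/eqP; rewrite subr_eq0; apply/eqP.
  under eq_bigr => j _ do rewrite mxE big_distrl.
  rewrite exchange_big; apply: eq_bigr => i _ /=.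
  rewrite big_distrr; apply: eq_bigr => j _ /=.
  by rewrite !mxE mulrAC mulrC.
rewrite !lcoefB yv !lcoef_sum !big1 ?subrr// => [i _|j _]; first by rewrite -lpolyM.
(* The coefficient of z^e in x, e <= [vdeg x], meets depth e + 1 < [r k]; hence the 2 in the
   hypothesis. *)
rewrite mulrC (lcoef_polyM _ _ (size_le_vdeg x j)) big1// => -[e et] _.
rewrite (_ : Negz 0 - _ = Negz e); last by rewrite /=; lia.
by rewrite Ay_small ?mulr0//=; lia.
Qed.

(** For the least usable k one has n s_k <= m (deg x + 1), which makes (m/n) deg x - (s_k + 1) at
    least -1 - m/n. *)
Lemma Bad_of_coef (theta : 'cV[laurent F]_n) (eps : R) :
  (forall i, lnorm R (theta i 0) < 1) ->
  (forall k, lcoef (\sum_i lpoly (y k i 0) * theta i 0) (Negz 0) != 0) ->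
  eps <= q `^ (- 1 - m%:R / n%:R) -> Bad eps A theta.
Proof.
move=> theta1 theta_k eps_le; split=> //.
(* The bound holds for every nonzero x, so the threshold 0 suffices for the lower limit. *)
apply: le_trans (ereal_sup_ubound _); last by exists 0 => //; reflexivity.
apply: le_ereal_inf_tmp => _ [x /= x0 <-]; rewrite lee_fin.
have xn0 : x != 0.
  apply: contraTneq x0 => ->; rewrite -leNgt.
  apply/bigmax_leP; split=> // i _; rewrite !mxE.
  by rewrite (_ : lpoly 0 = 0) ?/lnorm ?eqxx//; apply: laurentP => -[k|k]//=; rewrite coef0.
rewrite vnorm_vpoly//.
have exk : exists k, (vdeg x + 2 <= r k)%N.
  exists (m * (vdeg x + 2))%N.
  rewrite -(leq_pmul2l m_gt0) (leq_trans _ (rs _))//.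
  by rewrite (leq_trans (leq_degrees _))// (leq_trans (ltnW (s_mono _)))// leq_pmull.
case: (ex_minnP exk) => k kr kmin.
apply: (le_trans eps_le); have q0 := card_field_gt0 R F.
apply: (@le_trans _ _ ((q ^+ vdeg x) `^ (m%:R / n%:R) * q ^ Negz (s k))); last first.
  by rewrite ler_wpM2l ?powR_ge0// poly_dist_ge.
have -> : q ^ Negz (s k) = q `^ (- (s k).+1%:R) by rewrite powR_invn// ltW.
rewrite -powR_mulrn ?(ltW q0)// -powRrM -powRD; last by rewrite (gt_eqF q0) implybT.
rewrite ler_powR ?(ltW (card_field_gt1 _ _))//.
have nR : 0 < n%:R :> R by rewrite ltr0n.
(* For k = 0 the left side is 0; otherwise minimality gives r_(k-1) <= deg x + 1, and [rs] applies
   at k - 1. *)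
have : (n * s k <= m * (vdeg x).+1)%N.
  case: k kr kmin => [|k] kr kmin; first by rewrite s0 muln0.
  apply: leq_trans (rs k) _; rewrite leq_pmul2l// leqNgt; apply/negP => rk.
  by have := kmin k; rewrite addn2 rk ltnn => /(_ isT).
rewrite -(ler_nat R) !natrM -!natr1 => H.
rewrite -subr_ge0; have -> : (vdeg x)%:R * (m%:R / n%:R) - ((s k)%:R + 1) - (- 1 - m%:R / n%:R) =
  (m%:R * ((vdeg x)%:R + 1) - n%:R * (s k)%:R) / n%:R :> R.
  by field; rewrite gt_eqF.
by rewrite divr_ge0 ?subr_ge0// ltW.
Qed.

End BadMembership.

(** * Counting the nonzeros of an affine form over a finite field *)

Section AvoidedCoefficient.
Variables (F : finFieldType) (n : nat).
Implicit Types (l v : 'cV[F]_n).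

(** The fibres of a nonconstant affine form are translates of one another, so each is at most as
    large as the fibre over 1, which lies in the set counted. *)
Lemma card_affine_neq0 l (a : F) : l != 0 ->
  (#|F| ^ n <= #|F| * #|[pred v : 'cV[F]_n | (a + \sum_i l i 0 * v i 0 != 0)%R]|)%N.
Proof.
move=> l0; pose f v := a + \sum_i l i 0 * v i 0.
have [i] := cV_neqP l0; rewrite mxE => li.
pose u : 'cV[F]_n := \col_j (if j == i then (l i 0)^-1 else 0).
have fu v c : f (v + c *: u) = f v + c.
  rewrite /f -addrA; congr (_ + _).
  under eq_bigr do rewrite !mxE mulrDr.
  rewrite big_split/=; congr (_ + _).
  rewrite (bigD1 i)//= eqxx big1 ?addr0; last by move=> j /negPf ->; rewrite !mulr0.
  by rewrite mulrCA divff// mulr1.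
have -> : (#|F| ^ n = #|{: 'cV[F]_n}|)%N by rewrite card_mx muln1.
rewrite -sum1_card (partition_big f xpredT)//=.
rewrite -[X in (_ <= X * _)%N]/(#|{: F}|) -sum_nat_const.
apply: leq_sum => c _; rewrite sum1_card -/f.
pose g v := v + (1 - c) *: u.
rewrite -(@card_in_image _ _ g [pred v | f v == c]); last by move=> v w _ _ /addIr.
apply: fintype.subset_leq_card; apply/fintype.subsetP => _ /fintype.imageP[v /eqP fv ->].
by rewrite !inE -/(f _) fu fv addrCA subrr addr0 oner_neq0.
Qed.

End AvoidedCoefficient.

(** * The tree of digit sequences with nonzero pairings *)

Section DimensionLowerBound.
Variables (R : realType) (F : finFieldType) (n : nat).
Variables (y : nat -> 'cV[{poly F}]_n) (s : nat -> nat).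
Hypothesis n_gt0 : (0 < n)%N.
Hypothesis s_mono : forall k, (s k < s k.+1)%N.
Hypothesis size_y : forall k i, (size (y k i 0%R) <= (s k).+1)%N.
Hypothesis y_lead : forall k, exists i, (y k i 0)`_(s k) != 0.
Hypothesis s_superlinear :
  forall L, exists k0, forall k, (k0 <= k)%N -> (L * k <= s k)%N.
Local Notation q := (#|F|%:R : R).
Local Notation V := 'cV[F]_n.

Let leq_s k : (k <= s k)%N.
Proof. exact: leq_degrees. Qed.

Let s_lt i j : (i < j)%N -> (s i < s j)%N.
Proof. by apply: (homo_ltn ltn_trans s_mono). Qed.

Let s_inj : injective s.
Proof. by move=> i j sij; case: (ltngtP i j) => // /s_lt; rewrite sij ltnn. Qed.

Lemma ex_degree_ge D : exists k, (D <= s k)%N.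
Proof. by exists D. Qed.

(* As [s] is increasing, the least [k] with [D <= s k] is also the number of
   indices [k] with [s k < D]. *)
Definition deg_count D : nat := ex_minn (ex_degree_ge D).

Lemma deg_countS D : deg_count D.+1 =
  (deg_count D + `[< exists k, s k = D >])%N.
Proof.
have s_le i j : (i <= j)%N -> (s i <= s j)%N.
  by rewrite leq_eqVlt => /predU1P[->//|/s_lt/ltnW].
rewrite /deg_count; case: ex_minnP => k Dk kmin; case: ex_minnP => l Dl lmin.
have kl : (k <= l)%N || (l < k)%N by case: leqP.
case: asboolP => [[j sj]|noj] /=.
  have lj : (l <= j)%N by apply: lmin; rewrite sj.
  have sl : s l = D by apply/eqP; rewrite eqn_leq Dl -sj s_le.
  apply/eqP; rewrite addn1 eqn_leq kmin; last by rewrite -sl.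
  by rewrite ltnNge; apply/negP => /s_le; rewrite sl leqNgt Dk.
apply/eqP; rewrite addn0 eqn_leq kmin; last first.
  by rewrite ltn_neqAle Dl andbT; apply/eqP => Dsl; apply: noj; exists l.
by rewrite lmin// ltnW.
Qed.

(** If the count is k + 1 then s_k < D, and L k <= s_k unless k is small; the small k are absorbed
    in the constant. *)
Lemma deg_count_sublinear L : exists c, forall D, (L * deg_count D <= D + c)%N.
Proof.
have [k0 Hk0] := s_superlinear L.
exists (L * k0.+1)%N => D; rewrite /deg_count; case: ex_minnP => k Dk kmin.
case: k Dk kmin => [|k] Dk kmin; first by rewrite muln0.
have skD : (s k < D)%N by rewrite ltnNge; apply/negP => /kmin; rewrite ltnn.
have [kk0|k0k] := ltnP k k0.
  by rewrite (leq_trans _ (leq_addl _ _))// leq_mul2l (ltnW _) ?orbT// ltnS.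
by have := Hk0 _ k0k; rewrite !mulnS; lia.
Qed.

Definition series_of_digits (d : nat -> V) (i : 'I_n) : laurent F.
refine (@Laurent F (fun k => if k is Negz j then d j i 0 else 0) _).
by exists 0 => -[[|k]|k].
Defined.

Definition vseries d : 'cV[laurent F]_n := \col_i series_of_digits d i.

Lemma lnorm_vseries d i : lnorm R (vseries d i 0) < 1.
Proof. by apply/(@lnorm_lt _ _ _ 0) => -[k|k] // _; rewrite mxE. Qed.

Lemma vdist_vseries d d' D : d D != d' D ->
  q^-1 ^+ D.+1 <= vdist R (vseries d) (vseries d').
Proof.
move=> /cV_neqP[i di].
rewrite exprVn; apply: (@vnorm_ge _ _ _ _ i (Negz D)).
by rewrite !mxE lcoefB/= subr_eq0.
Qed.

Lemma lcoef_pairing d k :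
  lcoef (\sum_i lpoly (y k i 0) * vseries d i 0) (Negz 0) =
  \sum_(i < n) \sum_(e < (s k).+1) (y k i 0)`_e * d e i 0.
Proof.
rewrite lcoef_sum; apply: eq_bigr => i _; rewrite (lcoef_polyM _ _ (size_y k i)).
apply: eq_bigr => -[e es] _; rewrite mxE.
by rewrite (_ : Negz 0 - _ = Negz e)//=; lia.
Qed.

(* [t] lists the first digits of [theta] and [v] is the next one: the condition
   coming from the degree [s k] is tested once the digit at depth [s k] is known. *)
Definition good (t : seq V) : pred V := fun v => `[< forall k, s k = size t ->
  \sum_(i < n) \sum_(e < (s k).+1) (y k i 0)`_e * (nth 0 (rcons t v) e) i 0 != 0 >].

Lemma good_pairing d k : (forall D, good (mkseq d D) (d D)) ->
  lcoef (\sum_i lpoly (y k i 0) * vseries d i 0) (Negz 0) != 0.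
Proof.
move=> /(_ (s k))/asboolP/(_ k); rewrite size_mkseq => /(_ erefl).
rewrite lcoef_pairing -mkseqS; congr (_ != 0); apply: eq_bigr => i _.
by apply: eq_bigr => -[e es] _; rewrite nth_mkseq.
Qed.

(** At most one condition is tested at [t]; it is affine in the new digit, its linear part being the
    nonzero vector of coefficients of z^(s k) in [y k]. *)
Lemma card_good t :
  (#|F| ^ n <= #|F| ^ `[< exists k, s k = size t >] * #|good t|)%N.
Proof.
have [/asboolP[k sk]|/asboolPn nok] := boolP `[< _ >]; last first.
  rewrite mul1n -[X in (_ ^ X <= _)%N](muln1 n) -card_mx.
  apply: fintype.subset_leq_card; apply/fintype.subsetP => v _; apply/asboolP => k sk.
  by exfalso; apply: nok; exists k.
pose l : V := \col_i (y k i 0)`_(s k).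
have l0 : l != 0.
  by have [i yi] := y_lead k; apply: contraNneq yi => /colP/(_ i); rewrite !mxE => ->.
pose a := \sum_(i < n) \sum_(e < s k) (y k i 0)`_e * (nth 0 t e) i 0.
apply: leq_trans (card_affine_neq0 a l0) _; rewrite expn1 leq_mul2l.
apply/orP; right; apply: fintype.subset_leq_card; apply/fintype.subsetP => v; rewrite !inE => av.
move=> k'; rewrite -sk => /s_inj ->; apply: contraNneq av => sum0; rewrite -[X in _ == X]sum0.
rewrite /a -big_split/=; apply/eqP/eq_bigr => i _.
rewrite big_ord_recr/= nth_rcons sk ltnn eqxx mxE; congr (_ + _); last by rewrite sk.
by apply: eq_bigr => -[e es] _ /=; rewrite nth_rcons es.
Qed.

(* A lower bound for the branching turns [w] into a mass distribution: nodes at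
   depth [D] that satisfy the first [deg_count D] conditions get weight [w D]. *)
Let w D : R := q ^+ deg_count D / q ^+ (n * D).

Let q0 : 0 < q. Proof. exact: card_field_gt0. Qed.

Lemma weight_le t : 0 <= t -> t < n%:R ->
  exists2 C : R, 0 < C & forall D, w D <= C * (q^-1 ^+ D.+1) `^ t.
Proof.
move=> t0 tn; have d0 : 0 < n%:R - t by rewrite subr_gt0.
(* As L exceeds 1/(n - t), the (D + c)/L conditions met up to depth D cost at most D (n - t) + c in
   the exponent. *)
pose L := (Num.truncn (n%:R - t)^-1).+1.
have L0 : 0 < L%:R :> R by rewrite ltr0n.
have Ld : 1 <= L%:R * (n%:R - t).
  by rewrite -ler_pdivrMr// mul1r ltW// /L truncnS_gt.
have [c Hc] := deg_count_sublinear L.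
exists (q `^ (c%:R + t)); first exact: powR_gt0.
move=> D; rewrite powR_exprC ?invr_ge0 ?(ltW q0)// powR_inv ?(ltW q0)//.
rewrite -powR_mulrn ?powR_ge0// -powRrM -powRD ?(gt_eqF q0) ?implybT//.
rewrite /w -!powR_mulrn ?(ltW q0)// -powRB ?(gt_eqF q0) ?implybT//.
rewrite ler_powR ?(ltW (card_field_gt1 _ _))//.
have := Hc D; rewrite -(ler_nat R) natrM natrD => HcD.
have c0 : 0 <= c%:R :> R by []. have D0 : 0 <= D%:R :> R by [].
rewrite natrM -natr1.
suff : (deg_count D)%:R <= c%:R + D%:R * (n%:R - t) by lra.
rewrite -(ler_pM2l L0); apply: le_trans HcD _; rewrite -subr_ge0.
have -> : L%:R * (c%:R + D%:R * (n%:R - t)) - (D%:R + c%:R) =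
    c%:R * (L%:R - 1) + D%:R * (L%:R * (n%:R - t) - 1) by ring.
by rewrite addr_ge0// mulr_ge0// subr_ge0// ler1n.
Qed.

Lemma hausdorff_dim_ge (E : set 'cV[laurent F]_n) :
  (forall theta : 'cV[laurent F]_n, (forall i, lnorm R (theta i 0) < 1) ->
     (forall k, lcoef (\sum_i lpoly (y k i 0) * theta i 0) (Negz 0) != 0) ->
     E theta) ->
  (n%:R%:E <= hausdorff_dim (@vdist R F n) E)%E.
Proof.
move=> HE; apply: le_ereal_inf_tmp => _ [t [t0 Ht] <-]; rewrite lee_fin leNgt.
apply/negP => tn.
have [C C0 wC] := weight_le t0 tn.
have w0 D : 0 < w D by rewrite divr_gt0// exprn_gt0.
suff /eqP : hausdorff_measure (@vdist R F n) t E != 0%E by [].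
apply: (@hausdorff_measure_tree_neq0 _ _ _ _ 0 good w vseries E t q^-1 C) => //.
- by move=> D; apply: ltW.
(* One level down [w] is divided by q^n, and multiplied by q if a condition is tested; [card_good]
   supplies enough children. *)
- move=> u; rewrite /w deg_countS exprD mulnS exprD.
  rewrite -(ler_pM2r (exprn_gt0 n q0)).
  rewrite [leLHS](_ : _ = (q ^+ deg_count (size u) / q ^+ (n * size u)) * q ^+ n)//.
  rewrite [leRHS](_ : _ = (q ^+ deg_count (size u) / q ^+ (n * size u)) *
     ((#|F| ^ `[< exists k, s k = size u >])%N * #|good u|)%:R); last first.
    by rewrite natrM natrX; field; rewrite !expf_neq0 ?gt_eqF.
  by rewrite ler_wpM2l ?(ltW (w0 _))// -natrX ler_nat card_good.
- by move=> d gd; apply: HE => [i|k]; [exact: lnorm_vseries|exact: good_pairing].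
- exact: vdist_vseries.
- move=> eta eta0.
  (* The exponent t may be 0, which gives no decay; n/2 is positive and below n. *)
  have n2 : 0 < n%:R / 2 :> R by rewrite divr_gt0// ltr0n.
  have [||C' C'0 wC'] := @weight_le (n%:R / 2); rewrite ?(ltW n2)//; first by lra.
  have [||N HN] := @expr_eventually_le R (q^-1 `^ (n%:R / 2)) (eta / C').
  + by rewrite powR_ge0 powR_inv ?(ltW q0)// powR_lt1 ?card_field_gt1// oppr_lt0.
  + by rewrite divr_gt0.
  exists N; apply: le_trans (wC' N) _.
  rewrite powR_exprC ?invr_ge0 ?(ltW q0)// mulrC -ler_pdivlMr//.
  by apply: HN.
Qed.

End DimensionLowerBound.

(** * The dimension of [Bad] from a sequence of polynomial vectors *)

Section DimensionOfBad.
Variables (R : realType) (F : finFieldType) (m n : nat) (A : 'M[laurent F]_(n, m)).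
Variables (y : nat -> 'cV[{poly F}]_n) (s r : nat -> nat).
Local Notation q := (#|F|%:R : R).

Lemma hausdorff_dim_Bad (eps : R) : (0 < m)%N -> (0 < n)%N ->
  s 0%N = 0%N -> (forall k, (s k < s k.+1)%N) ->
  (forall k i, (size (y k i 0%R) <= (s k).+1)%N) ->
  (forall k, exists i, (y k i 0)`_(s k) != 0) ->
  (forall k j e, (e.+1 < r k)%N ->
     lcoef ((A^T *m vpoly (y k)) j 0) (Negz e) = 0) ->
  (forall k, (n * s k.+1 <= m * r k)%N) ->
  (forall L, exists k0, forall k, (k0 <= k)%N -> (L * k <= s k)%N) ->
  eps <= q `^ (- 1 - m%:R / n%:R) ->
  hausdorff_dim (@vdist R F n) (Bad eps A) = n%:R%:E.
Proof.
move=> m0 n0 s0 s_mono size_y y_lead Ay rs s_sup eps_le; apply/le_anti/andP; split.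
  by apply: hausdorff_dim_unit_ball_le => v [].
apply: (hausdorff_dim_ge n0 s_mono size_y y_lead s_sup) => theta th1 thk.
by apply: (Bad_of_coef n0 m0 s0 s_mono size_y Ay rs).
Qed.

End DimensionOfBad.

(** * Dirichlet's theorem and best approximations *)

Section SimultaneousApproximation.
Variables (R : realType) (F : finFieldType) (m n : nat) (A : 'M[laurent F]_(n, m)).
Local Notation q := (#|F|%:R : R).

Lemma vpolyB (u v : 'cV[{poly F}]_n) : vpoly (u - v) = vpoly u - vpoly v.
Proof.
apply/colP => i; rewrite !mxE; apply: laurentP => -[k|k] /=; first exact: coefB.
by rewrite oppr0 addr0.
Qed.

(** Pigeonhole: among q^(nS) polynomial vectors and q^(mt) blocks of digits, two vectors share a
    block, and their difference is the solution. *)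
Lemma dirichlet (S t : nat) : (m * t < n * S)%N ->
  exists x : 'cV[{poly F}]_n, [/\ x != 0, forall i, (size (x i 0%R) <= S)%N &
    forall j e, (e < t)%N -> lcoef ((A^T *m vpoly x) j 0) (Negz e) = 0].
Proof.
move=> mtnS; pose P (c : 'M[F]_(n, S)) : 'cV[{poly F}]_n := \col_i rVpoly (row i c).
pose f c := digits t (A^T *m vpoly (P c)).
have /injectivePn[c [c' cc' fcc']] : ~~ injectiveb f.
  apply/negP => /injectiveP f_inj; have := leq_card f f_inj.
  by rewrite !card_mx leq_exp2l ?finField_gt1// leqNgt mtnS.
exists (P c - P c'); split.
- apply: contraNneq cc' => /subr0_eq/colP PP; apply/eqP/row_matrixP => i.
  by have := PP i; rewrite !mxE => /(can_inj rVpolyK).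
- by move=> i; rewrite !mxE -linearB size_poly.
- move=> j e et; rewrite vpolyB mulmxBr !mxE lcoefB.
  have /matrixP/(_ j (Ordinal et)) := fcc'; rewrite !mxE/= => <-.
  exact: subrr.
Qed.

Variable y : nat -> 'cV[{poly F}]_n.
Hypothesis m_gt0 : (0 < m)%N.
Hypothesis n_gt0 : (0 < n)%N.
Hypothesis y_best : best_approximations R A y.
Hypothesis y_growth :
  (fun k : nat => vnorm R (vpoly (y k)) `^ (k%:R^-1)) @ \oo --> +oo.

Let s k := vdeg (y k.+1).

Let vnorm_y k : vnorm R (vpoly (y k.+1)) = q ^+ s k.
Proof. by rewrite vnorm_vpoly//; have [+ _ _ _ _] := y_best; apply. Qed.

Let s_mono k : (s k < s k.+1)%N.
Proof.
have [_ _ /(_ k.+1 isT) + _ _] := y_best.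
by rewrite !vnorm_y ltr_eXn2l// card_field_gt1.
Qed.

(** The growth hypothesis says that q^(s_k / (k+1)) eventually exceeds q^L. *)
Let s_superlinear L : exists k0, forall k, (k0 <= k)%N -> (L * k <= s k)%N.
Proof.
have /cvgryPge/(_ (q ^+ L))[k0 _ Hk0] := y_growth.
exists k0 => k k0k; have /= := Hk0 k.+1 (leqW k0k).
rewrite vnorm_y => /(@lerXn2r _ k.+1 _ _ (exprn_ge0 _ (ltW (card_field_gt0 R F))) (powR_ge0 _ _)).
rewrite -[leRHS]powR_mulrn ?powR_ge0// -powRrM mulVf// powRr1; last first.
  by rewrite exprn_ge0// ltW// card_field_gt0.
rewrite -exprM ler_eXn2l ?card_field_gt1//; apply: leq_trans.
by rewrite leq_mul2l leqnSn orbT.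
Qed.

Lemma hausdorff_dim_Bad_best_approximations (eps : R) :
  eps <= q `^ (- 1 - m%:R / n%:R) ->
  hausdorff_dim (@vdist R F n) (Bad eps A) = n%:R%:E.
Proof.
have q1 := card_field_gt1 R F.
(* The largest t with m t < n s_(k+1), as Dirichlet requires; then n s_(k+1) <= m (t + 1). *)
pose t k := ((n * s k.+1).-1 %/ m)%N.
apply: (@hausdorff_dim_Bad _ _ _ _ _ (fun k => y k.+1) s (fun k => (t k).+1)) => //.
- have [_ + _ _ _] := y_best; rewrite vnorm_y => /eqP.
  by have [//|s_gt0] := posnP (s 0%N); rewrite gt_eqF// exprn_egt1// -lt0n.
- by move=> k i; exact: size_le_vdeg.
- by move=> k; apply: vdeg_lead; have [+ _ _ _ _] := y_best; apply.
- move=> k j e; rewrite ltnS => et.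
  have sk0 : (0 < s k.+1)%N by apply: leq_trans (s_mono k).
  have [|x [x0 xs xe]] := @dirichlet (s k.+1) (t k).
    apply: (@leq_ltn_trans (n * s k.+1).-1); first by rewrite mulnC leq_trunc_div.
    by rewrite prednK// muln_gt0 n_gt0.
  have [_ _ _ _ /(_ k.+1 isT x x0) best] := y_best.
  (* The Dirichlet solution has degree below that of the next best approximation, so minimality
     passes its bound on to [y k.+1]. *)
  have /(@poly_dist_le _ _ _ _ (Negz (t k)) isT) : Mdist R A (y k.+1) <= q ^ Negz (t k).
    apply: (le_trans (best _)).
      rewrite vnorm_y vnorm_vpoly// ltr_eXn2l//.
      have : (vdeg x <= (s k.+1).-1)%N by apply/bigmax_leqP => i _; have := xs i; lia.
      by rewrite -ltnS prednK.
    apply/poly_dist_le => // i [e'|e']//= te' _; apply: xe; lia.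
  by apply => //; lia.
- move=> k; have := ltn_ceil (n * s k.+1).-1 m_gt0; rewrite -/(t k).
  by rewrite [((t k).+1 * m)%N]mulnC; case: (n * s k.+1)%N.
Qed.

End SimultaneousApproximation.

(** * Convergents of the continued fraction *)

Section ContinuedFractions.
Variables (R : realType) (F : finFieldType) (alpha : laurent F).
Local Notation q := (#|F|%:R : R).
Local Notation pq := (partial_quotient alpha).
Local Notation rem := (cf_rem alpha).

(** The product of the two top coefficients is a nonzero coefficient of 1, so its index is 0. *)
Lemma ldeg_inv (x : laurent F) : x != 0 -> ldeg x^-1 = - ldeg x.
Proof.
move=> x0; have y0 : x^-1 != 0 by rewrite invr_eq0.
have [xd dx] := lcoef_ldeg x0; have [yd dy] := lcoef_ldeg y0.
have : lcoef (x * x^-1) (ldeg x + ldeg x^-1 - 0%:Z) != 0.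
  rewrite -[lcoef _ _]/(lmul_coef x x^-1 _) (lmul_coefE dx dy).
  by rewrite big_ord_recl big_ord0 addr0 !subr0 mulf_neq0.
rewrite divff// subr0 -[lcoef _ _]/((ldeg x + ldeg x^-1 == 0)%:R).
by case: (ldeg x + ldeg x^-1 =P 0) => [E _|_]; [lia|rewrite eqxx].
Qed.

Lemma size_polypart_inv (x : laurent F) : x != 0 ->
  (forall k, 0 <= k -> lcoef x k = 0) ->
  (1 < size (polypart x^-1))%N /\
  forall k, - ((size (polypart x^-1)).-1)%:Z < k -> lcoef x k = 0.
Proof.
move=> x0 xk; have [xd dx] := lcoef_ldeg x0.
have d0 : ldeg x < 0 by rewrite ltNge; apply: contra xd => /xk ->.
have y0 : x^-1 != 0 by rewrite invr_eq0.
have [yd _] := lcoef_ldeg y0.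
have szE : size (polypart x^-1) = `|ldeg x^-1|.+1.
  rewrite /polypart size_poly_eq//.
  by rewrite gez0_abs// ldeg_inv//; lia.
rewrite szE ldeg_inv//; split; first by lia.
by move=> k dk; apply: dx; lia.
Qed.

(* [(u, v)] and [(A_1 u + v, u)], ...: the recursion satisfied by numerators and
   denominators of the convergents. *)
Fixpoint continuant (uv : {poly F} * {poly F}) k : {poly F} * {poly F} :=
  if k is k'.+1 then
    (pq k * (continuant uv k').1 + (continuant uv k').2, (continuant uv k').1)
  else uv.

(** The starting pairs encode Q_0 = 1, Q_(-1) = 0 here and P_0 = A_0, P_(-1) = 1 for the
    numerators. *)
Definition cf_den k := (continuant (1, 0) k).1.
Let den k := continuant (1, 0) k.
Let num k := continuant (pq 0, 1) k.
Let err1 k := lpoly (den k).1 * alpha - lpoly (num k).1.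
Let err2 k := lpoly (den k).2 * alpha - lpoly (num k).2.

Hypothesis irr : laurent_irrational alpha.

Let rem_frac k j : 0 <= j -> lcoef (rem k) j = 0.
Proof. by case: k => [|k]; exact: lcoef_polypart. Qed.

Let lpoly1 : lpoly (1 : {poly F}) = 1.
Proof. by apply: laurentP => -[k|k] //=; rewrite coef1. Qed.

Let lpoly0 : lpoly (0 : {poly F}) = 0.
Proof. by apply: laurentP => -[k|k] //=; rewrite coef0. Qed.

Let size_denS k : (1 < size (pq k.+1))%N ->
  (size (den k).2 < size (den k).1)%N ->
  size (den k.+1).1 = (size (pq k.+1) + size (den k).1).-1.
Proof.
move=> szA sz.
have A0 : pq k.+1 != 0 by rewrite -size_poly_gt0 (ltn_trans _ szA).
have d0 : (den k).1 != 0 by rewrite -size_poly_gt0 (leq_ltn_trans _ sz).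
have szM := size_mul A0 d0.
rewrite size_polyDl szM//; apply: leq_trans sz _.
by move: (size _) szA => a; move: (size _) => b; lia.
Qed.

(* The error terms satisfy the same recursion, hence decrease by the factor
   [- rem k] at each step. *)
Let convergentP k : [/\ rem k != 0, err1 k = - rem k * err2 k,
  (size (den k).2 < size (den k).1)%N &
  forall j, - ((size (den k).1).-1)%:Z < j -> lcoef (err2 k) j = 0].
Proof.
(* A vanishing remainder would make the error vanish and [alpha] equal to a convergent. *)
have rem_neq0 i : err1 i = - rem i * err2 i -> (size (den i).2 < size (den i).1)%N -> rem i != 0.
  move=> E sz; apply/eqP => r0; apply: irr; exists (num i).1, (den i).1.
  have d0 : (den i).1 != 0 by rewrite -size_poly_gt0 (leq_ltn_trans _ sz).
  split=> //; move: E; rewrite r0 oppr0 mul0r /err1 => /subr0_eq <-.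
  rewrite mulrAC divff ?mul1r//; apply: contra_neq d0 => /(congr1 (@lcoef F)) d0.
  by apply/polyP => j; have /= -> := congr1 (fun f => f j%:Z) d0; rewrite coef0.
elim: k => [|k [r0 E sz small]].
  have E0 : err1 0 = - rem 0 * err2 0.
    by rewrite /err1 /err2 /den /num /= lpoly1 lpoly0 mul0r mul1r sub0r mulrNN mulr1.
  have sz0 : (size (den 0).2 < size (den 0).1)%N by rewrite /den /= size_poly0 size_poly1.
  split=> //; first exact: rem_neq0.
  have -> : err2 0 = - 1 by rewrite /err2 /den /num /= lpoly1 lpoly0 mul0r sub0r.
  rewrite /den size_poly1 => -[[|j]|j] //= _.
  by rewrite oppr0.
have [] := size_polypart_inv r0 (@rem_frac k); rewrite -/(pq k.+1) => szA Asmall.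
have szD := size_denS szA sz.
have E' : err1 k.+1 = - rem k.+1 * err2 k.+1.
  have -> : err2 k.+1 = err1 k by [].
  have -> : err1 k.+1 = lpoly (pq k.+1) * err1 k + err2 k.
    by rewrite /err1 /err2 /= !lpolyD !lpolyM; ring.
  have -> : err2 k = - (rem k)^-1 * err1 k by rewrite E mulrA mulrNN mulVf// mul1r.
  by rewrite [rem k.+1]/(_ - lpoly (pq k.+1)); rewrite opprB mulrBl mulNr.
have sz' : (size (den k.+1).2 < size (den k.+1).1)%N.
  by rewrite szD [(den k.+1).2]/((den k).1); move: (size _) szA => sA; move: (size _) => sB; lia.
split=> //; first exact: rem_neq0.
move=> j; rewrite szD => jd; have -> : err2 k.+1 = err1 k by [].
(* Degrees add: [rem k] has degree at most -deg A_(k+1), and [err2 k] at most -deg Q_k. *)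
rewrite E mulNr; apply/eqP; rewrite oppr_eq0; apply/eqP.
apply: (lcoefM_high Asmall small).
have aux (a b : nat) : (1 < a)%N -> (0 < b)%N -> (a + b)%N.-2%:Z = a.-1%:Z + b.-1%:Z by lia.
by rewrite -opprD -(aux _ _ szA (leq_ltn_trans (leq0n _) sz)).
Qed.

Let s k := (size (cf_den k)).-1.

Let size_pq k : (1 < size (pq k.+1))%N.
Proof.
by have [r0 _ _ _] := convergentP k; have [] := size_polypart_inv r0 (@rem_frac k).
Qed.

Let cf_den_neq0 k : cf_den k != 0.
Proof.
by have [_ _ sz _] := convergentP k; rewrite -size_poly_gt0 (leq_ltn_trans _ sz).
Qed.

Let sS k : s k.+1 = ((size (pq k.+1)).-1 + s k)%N.
Proof.
have [_ _ sz _] := convergentP k; have szA := size_pq k.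
have sd : (0 < size (cf_den k))%N by rewrite size_poly_gt0.
have aux a b : (1 < a -> 0 < b -> (a + b).-1.-1 = a.-1 + b.-1)%N by lia.
by rewrite /s /cf_den size_denS//; apply: aux.
Qed.

Lemma hausdorff_dim_Bad_continued_fraction (eps : R) :
  (fun i : nat => (size (pq i)).-1) @ \oo --> \oo ->
  eps <= #|F|%:R ^- 2 ->
  hausdorff_dim (@vdist R F 1) (Bad eps (alpha%:M : 'M[laurent F]_1)) = 1%:E.
Proof.
move=> pq_oo eps_le; have q0 := card_field_gt0 R F.
apply: (@hausdorff_dim_Bad _ _ 1 1 _ (fun k => const_mx (cf_den k)) s (fun k => s k.+1)) => //.
- by rewrite /s /cf_den /= size_poly1.
- by move=> k; rewrite sS; have := size_pq k; lia.
- by move=> k i; rewrite mxE leqSpred.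
- by move=> k; exists 0; rewrite mxE -/(lead_coef _) lead_coef_eq0.
- move=> k j e ek; rewrite ord1 tr_scalar_mx mul_scalar_mx !mxE mulrC.
  rewrite -(@lcoef_subpoly _ _ (num k).1)//.
  have [_ _ _ small] := convergentP k.+1.
  apply: (small (Negz e)); rewrite -/(cf_den k.+1) -/(s k.+1).
  by lia.
(* Beyond [i0] each partial quotient adds at least 2 L to the degree; for k >= 2 [i0] at least half
   of the k steps lie there, which leaves L k. *)
- move=> L; have [i0 _ Hi0] : \forall i \near \oo, (2 * L <= (size (pq i)).-1)%N.
    by move/cvgnyPge: pq_oo; apply.
  have Hs k : (2 * L * k <= s (i0 + k))%N.
    elim: k => [|k IH]; first by rewrite muln0.
    rewrite addnS sS mulnS leq_add//; apply: Hi0; rewrite /=; lia.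
  exists (2 * i0)%N => k ik; have := Hs (k - i0)%N; rewrite subnKC; last by lia.
  apply: leq_trans; rewrite [(2 * L)%N]mulnC -mulnA leq_mul2l; apply/orP; right; lia.
- apply: le_trans eps_le _; rewrite divr1 -opprD -[1 + 1]/(2%:R).
  by rewrite powR_invn// ltW.
Qed.

End ContinuedFractions.

Theorem theorem1p4 (R : realType) (F : finFieldType) :
  (forall (m n : nat) (A : 'M[laurent F]_(n, m)) (y : nat -> 'cV[{poly F}]_n),
     (0 < m)%N -> (0 < n)%N ->
     best_approximations R A y ->
     (fun k : nat => vnorm R (vpoly (y k)) `^ (k%:R^-1)) @ \oo --> +oo ->
     (exists eps : R, 0 < eps /\
        hausdorff_dim (@vdist R F n) (Bad eps A) = n%:R%:E) /\
     (forall eps : R, 0 < eps ->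
        eps < #|F|%:R `^ (- 4 - m%:R / n%:R) ->
        hausdorff_dim (@vdist R F n) (Bad eps A) = n%:R%:E)) /\
  (forall alpha : laurent F,
     laurent_irrational alpha ->
     (fun i : nat => (size (partial_quotient alpha i)).-1) @ \oo --> \oo ->
     forall eps : R, 0 < eps -> eps <= #|F|%:R ^- 2 ->
       hausdorff_dim (@vdist R F 1) (Bad eps (alpha%:M : 'M[laurent F]_1)) = 1%:E).
Proof.
split=> [m n A y m0 n0 y_best y_growth|alpha irr pq_oo eps _ eps_le]; last first.
  exact: hausdorff_dim_Bad_continued_fraction.
have q0 := card_field_gt0 R F.
split=> [|eps _ eps_lt].
  (* The argument reaches q^(-1 - m/n), which exceeds the required q^(-4 - m/n) and serves as the
     witness. *)
  exists (#|F|%:R `^ (- 1 - m%:R / n%:R)); split; first exact: powR_gt0.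
  exact: (hausdorff_dim_Bad_best_approximations m0 n0 y_best).
apply: (hausdorff_dim_Bad_best_approximations m0 n0 y_best y_growth).
apply: le_trans (ltW eps_lt) _.
by rewrite ler_powR ?(ltW (card_field_gt1 _ _))// lerD2r lerN2 ler1n.
Qed.
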